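(* For all integers $k,n,m\geqslant 0$, the poset $\Sigma^k_n C^n_m$ is isomorphic to the subposet of $C^n_{k+m}$ consisting of those elements $(x_1,\dots,x_n)$ satisfying the condition: for each $i\in\{1,\dots,n-1\}$, if $x_{i+1}\in\{0,\dots,k-1\}$ then $x_i\leqslant x_{i+1}$. Moreover, this subposet is a sublattice of $C^n_{k+m}$.
   Context: For $r\geqslant 0$, $C_r$ is the chain $\{0<1<\dots<r\}$ and $C_r^n$ its $n$-th cartesian power with componentwise order (a lattice with componentwise min and max). Stacking (lax sum): given a sequence of posets $M_0,M_1,M_2,\dots$ with monotone maps $f_j\colon M_j\to M_{j+1}$, the poset $\Sigma_nM_n$ has elements the pairs $(x,j)$ with $0\leqslant j\leqslant n$, $x\in M_j$, ordered by $(x,j)\leqslant(y,k)$ iff $j\leqslant k$ and $(f_{k-1}\circ\dots\circ f_j)(x)\leqslant y$ in $M_k$ (identity composite when $j=k$). The maps $f'_n\colon\Sigma_nM_n\to\Sigma_{n+1}M_{n+1}$, $(x,j)\mapsto(x,j)$, make $(\Sigma_nM_n)_{n\geqslant0}$ again such a sequence. Iterated stacking: $\Sigma^0_nM_n=M_n$ and $\Sigma^{k}_nM_n$ is the stacking of the sequence $(\Sigma^{k-1}_nM_n)_{n\geqslant 0}$ with the maps just described. $\Sigma^k_nC^n_m$ denotes the $k$-iterated stacking of the sequence $C^0_m\to C^1_m\to C^2_m\to\dots$ with maps $(x_1,\dots,x_i)\mapsto(0,x_1,\dots,x_i)$. *)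

(* Defs.v *)
From HB Require Import structures.
From mathcomp Require Import all_boot all_order.

Set Implicit Arguments.
Unset Strict Implicit.
Unset Printing Implicit Defensive.

Import Order.TTheory.
Local Open Scope order_scope.

Definition poset_iso d d' (P : porderType d) (Q : porderType d') : Prop :=
  exists2 f : P -> Q, bijective f & {mono f : x y / x <= y}.

Definition sublattice d (L : latticeType d) (S : {pred L}) : Prop :=
  Order.ClosedPredicates.meet_closed S /\ Order.ClosedPredicates.join_closed S.

Record poset_seq (d : Order.disp_t) := PosetSeq {
  pobj :> nat -> porderType d;
  pstep : forall n, pobj n -> pobj n.+1;
  pstep_homo : forall n, {homo @pstep n : x y / x <= y}
}.
Arguments pstep {d} M n x : rename.

Section Stacking.
Variables (d : Order.disp_t) (M : poset_seq d).

Fixpoint push (i j : nat) (x : M j) : M (i + j)%N :=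
  if i is i'.+1 return M (i + j)%N then pstep M (i' + j) (push i' x) else x.

(* The composite f_(k-1) o ... o f_j; the cast is along k - j + j = k. *)
Definition push_to (j k : nat) (le_jk : (j <= k)%N) (x : M j) : M k :=
  ecast l (M l) (subnK le_jk) (push (k - j) x).

(* The pair (x, j) is represented with its level j first. *)
Definition stacking (n : nat) : Type := {j : 'I_n.+1 & M j}.

HB.instance Definition _ n := Choice.on (stacking n).

Definition stack_elt n (j : 'I_n.+1) (x : M j) : stacking n :=
  Tagged (fun j : 'I_n.+1 => M j) x.

Definition le_stacking n (u v : stacking n) : bool :=
  if @idP (tag u <= tag v)%N is ReflectT le_uv
  then push_to le_uv (tagged u) <= tagged v else false.

Lemma le_stackingP n (u v : stacking n) :
  reflect (exists le_uv : (tag u <= tag v)%N,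
             push_to le_uv (tagged u) <= tagged v)
          (le_stacking u v).
Proof.
rewrite /le_stacking; case: {-}_ / idP => [le_uv|nle_uv]; last first.
  by right=> -[le_uv _]; apply: nle_uv.
apply: (iffP idP) => [le_p|[le_uv' le_p]]; first by exists le_uv.
by rewrite (bool_irrelevance le_uv le_uv').
Qed.

Lemma push_toE j k (le_jk : (j <= k)%N) (x : M j) i (e : (i + j)%N = k) :
  push_to le_jk x = ecast l (M l) e (push i x).
Proof.
rewrite /push_to; move: (subnK le_jk).
have -> : (k - j)%N = i by rewrite -e addnK.
by move=> e'; rewrite (eq_irrelevance e e').
Qed.

Lemma push_to_id j (le_jj : (j <= j)%N) (x : M j) : push_to le_jj x = x.
Proof. exact: (@push_toE j j le_jj x 0 erefl). Qed.

Lemma push_toS j k (le_jk : (j <= k)%N) (le_jk1 : (j <= k.+1)%N) (x : M j) :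
  push_to le_jk1 x = pstep M k (push_to le_jk x).
Proof.
rewrite (@push_toE _ _ _ x (k - j).+1 (congr1 S (subnK le_jk))) /push_to.
by move: (k - j)%N (subnK le_jk) => i e; subst k.
Qed.

Lemma push_to_trans j k l (le_jk : (j <= k)%N) (le_kl : (k <= l)%N)
    (le_jl : (j <= l)%N) (x : M j) :
  push_to le_kl (push_to le_jk x) = push_to le_jl x.
Proof.
elim: l le_kl le_jl => [|l IHl] le_kl le_jl.
  have k0 : k = 0%N by apply/eqP; rewrite -leqn0.
  by subst k; rewrite push_to_id (bool_irrelevance le_jk le_jl).
have [lt_kl|] := boolP (k <= l)%N; last first.
  rewrite -ltnNge => lt_lk; have kl : k = l.+1 by apply/eqP; rewrite eqn_leq le_kl.
  by subst k; rewrite push_to_id (bool_irrelevance le_jk le_jl).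
have le_jl' := leq_trans le_jk lt_kl.
by rewrite (push_toS lt_kl) (push_toS le_jl') (IHl _ le_jl').
Qed.

Lemma push_to_homo j k (le_jk : (j <= k)%N) :
  {homo push_to le_jk : x y / x <= y}.
Proof.
elim: k le_jk => [|k IHk] le_jk x y le_xy.
  have j0 : j = 0%N by apply/eqP; rewrite -leqn0.
  by subst j; rewrite !push_to_id.
have [le_jk'|] := boolP (j <= k)%N; last first.
  rewrite -ltnNge => lt_kj; have jk : j = k.+1 by apply/eqP; rewrite eqn_leq le_jk.
  by subst j; rewrite !push_to_id.
by rewrite !(push_toS le_jk'); apply/pstep_homo/IHk.
Qed.

Fact le_stacking_refl n : reflexive (@le_stacking n).
Proof. by move=> u; apply/le_stackingP; exists (leqnn _); rewrite push_to_id. Qed.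

Fact le_stacking_anti n : antisymmetric (@le_stacking n).
Proof.
move=> [j x] [k y] /andP[/le_stackingP[/= le_jk le_xy] /le_stackingP[/= le_kj]].
have jk : j = k by apply/val_inj/eqP; rewrite eqn_leq le_jk.
subst k; move: le_xy; rewrite !push_to_id => le_xy le_yx.
by congr (existT _ _ _); apply/le_anti; rewrite le_xy.
Qed.

Fact le_stacking_trans n : transitive (@le_stacking n).
Proof.
move=> [k y] [j x] [l z] /le_stackingP[/= le_jk le_xy] /le_stackingP[/= le_kl le_yz].
apply/le_stackingP => /=; exists (leq_trans le_jk le_kl).
rewrite -(push_to_trans le_jk le_kl); apply: le_trans le_yz.
exact: push_to_homo.
Qed.

HB.instance Definition _ n := Order.Le_isPOrder.Build d (stacking n)
  (@le_stacking_refl n) (@le_stacking_anti n) (@le_stacking_trans n).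

Definition stacking_map n (u : stacking n) : stacking n.+1 :=
  @stack_elt n.+1 (widen_ord (leqnSn n.+1) (tag u)) (tagged u).

Fact stacking_map_homo n : {homo @stacking_map n : u v / u <= v}.
Proof. by []. Qed.

Definition stack : poset_seq d :=
  @PosetSeq d (fun n => stacking n) stacking_map stacking_map_homo.

End Stacking.

Fixpoint iter_stack d (k : nat) (M : poset_seq d) : poset_seq d :=
  if k is k'.+1 then stack (iter_stack k' M) else M.

Notation chain_pow r n := (n.-tupleprod 'I_r.+1).

Definition pad0 (r n : nat) (x : chain_pow r n) : chain_pow r n.+1 :=
  [tuple of ord0 :: x].

Fact pad0_homo r n : {homo @pad0 r n : x y / x <= y}.
Proof.
move=> x y; rewrite !leEtprod => /forallP le_xy; apply/forallP => i.
by case: (unliftP ord0 i) => [j|] ->; rewrite ?tnthS ?tnth0.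
Qed.

Definition chain_pow_seq (m : nat) :=
  @PosetSeq _ (fun n => chain_pow m n) (@pad0 m) (@pad0_homo m).

(* Coordinates are numbered from 0 here, so tnth x i is x_(i+1); s is the
   position following i. *)
Definition slope_cond (k r n : nat) : {pred chain_pow r n} :=
  [pred x : chain_pow r n | [forall i : 'I_n, forall s : 'I_n,
     (s == i.+1 :> nat) ==> (tnth x s < k)%N ==> (tnth x i <= tnth x s)]].
Arguments slope_cond : clear implicits.

Definition slope_poset (k r n : nat) : Type := {x : chain_pow r n | x \in slope_cond k r n}.

HB.instance Definition _ k r n := SubChoice.on (slope_poset k r n).
HB.instance Definition _ k r n :=
  [SubChoice_isSubPOrder of slope_poset k r n by <:
     with Order.seqprod_display preorder.Order.OrdinalOrder.ord_display].

(* Main.v *)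
Require Import Defs.
From mathcomp Require Import all_boot all_order.

Set Implicit Arguments.
Unset Strict Implicit.
Unset Printing Implicit Defensive.

Import Order.TTheory.

(** A word satisfying the condition for [k + 1] has all its zeros at the front,
    since [x_(i+1) = 0] forces [x_i = 0]; hence it is uniquely
    [0^(n-j) (y_1 + 1) ... (y_j + 1)] with [y] a word of length [j] satisfying
    the condition for [k].  So [(y, j) |-> 0^(n-j) (y + 1)] identifies one
    stacking of the posets for [k] with the posets for [k + 1], and it turns the
    transition maps again into padding by [0], which lets the induction on [k]
    proceed.  Words are handled as sequences of natural numbers, so that
    elements of different levels live in a single type. *)

Definition slope_rel (k : nat) : rel nat := fun a b => (b < k) ==> (a <= b).

Definition slope_word (k r : nat) : pred (seq nat) :=
  fun s => all (geq r) s && sorted (slope_rel k) s.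

(** Injectivity of each [e n] follows from [represents_le] by antisymmetry. In [represents_surj] the
    level is read off as the length of the word. Comparisons between levels reduce to
    [represents_le] by means of [represents_step]. *)
Record represents d (M : poset_seq d) (e : forall n, M n -> seq nat)
    (P : pred (seq nat)) : Prop := Represents {
  represents_size : forall n x, size (@e n x) = n;
  represents_mem : forall n x, P (@e n x);
  represents_surj : forall s, P s -> exists x : M (size s), e _ x = s;
  represents_le : forall n (x y : M n), all2 leq (e _ x) (e _ y) = (x <= y)%O;
  represents_step : forall n x, e n.+1 (pstep M n x) = 0 :: e n x
}.

Definition stack_word d (M : poset_seq d) (e : forall n, M n -> seq nat)
    n (u : stack M n) : seq nat :=
  nseq (n - tag u) 0 ++ map S (e (tag u) (tagged u)).

Lemma all2_leq_nseq0 a s t :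
  all2 leq (nseq a 0 ++ s) (nseq a 0 ++ t) = all2 leq s t.
Proof. by elim: a. Qed.

(** The first [b] comparisons have 0 on the left and hold on both sides; in the remaining ones the
    successors cancel. *)
Lemma all2_leq_nseq0_mapS b s t :
  all2 leq (nseq b 0 ++ map S s) (map S t) = all2 leq (nseq b 0 ++ s) t.
Proof.
elim: b t => [|b IHb] [|c t] //=; first by case: s.
by elim: s c t => [|a s IHs] c [|c' t] //=; rewrite ltnS -?IHs //; case: s {IHs}.
Qed.

(** Shifting the entries together with [k] and [r] changes no comparison, and a pair whose first
    entry is 0 always satisfies [slope_rel]. *)
Lemma slope_wordS k r a s :
  slope_word k.+1 r.+1 (nseq a 0 ++ map S s) = slope_word k r s.
Proof.
rewrite /slope_word all_cat all_nseq orbT all_map.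
congr (_ && _); elim: a => [|[|a] IHa] /=; last by rewrite -IHa.
- by rewrite sorted_map; apply: eq_sorted => b c; rewrite /slope_rel/= !ltnS.
- by rewrite -IHa; case: s {IHa} => //= b s; rewrite /slope_rel implybT.
Qed.

Lemma slope_wordS_decomp k r s : slope_word k.+1 r.+1 s ->
  exists a t, s = nseq a 0 ++ map S t.
Proof.
case/andP=> _; elim: s => [|x s IHs] ss; first by exists 0, [::].
have [a [t Ds]] := IHs (path_sorted ss).
case: x ss => [|x] ss; first by exists a.+1, t; rewrite Ds.
case: a Ds => [|a] Ds; first by exists 0, (x :: t); rewrite Ds.
(* A positive entry followed by 0 is excluded, because 0 lies below the threshold [k.+1]. *)
by move: ss; rewrite Ds.
Qed.

Lemma represents_push_to d (M : poset_seq d) e P j k (le_jk : j <= k) (x : M j) :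
  represents e P -> e k (push_to le_jk x) = nseq (k - j) 0 ++ e j x.
Proof.
move=> rM; have Ek := subnK le_jk; rewrite (push_toE le_jk x Ek).
move: (k - j) Ek => i Ek; case: k / Ek {le_jk} => /=.
by elim: i => //= i IHi; rewrite (represents_step rM) IHi.
Qed.

Lemma represents_stack d (M : poset_seq d) e k r :
  represents e (slope_word k r) ->
  represents (@stack_word d M e) (slope_word k.+1 r.+1).
Proof.
move=> rM; have sz := represents_size rM; split.
- move=> n [j x]; rewrite /stack_word /= size_cat size_nseq size_map sz subnK //.
  by rewrite -ltnS.
- by move=> n [j x]; rewrite /stack_word slope_wordS (represents_mem rM).
- move=> s Ps; have [a [t Ds]] := slope_wordS_decomp Ps.
  move: Ps; rewrite Ds slope_wordS => /(represents_surj rM)[x Dx].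
  rewrite size_cat size_nseq size_map.
  have lt_t : size t < (a + size t).+1 by rewrite ltnS leq_addl.
  exists (@stack_elt _ M (a + size t) (Ordinal lt_t) x).
  by rewrite /stack_word /= Dx addnK.
- move=> n [j x] [l y]; rewrite /stack_word /=.
  apply/idP/le_stackingP=> [le_uv|] /=; last first.
    case=> le_jl; rewrite -(represents_le rM) (represents_push_to _ _ rM).
    (* The common [n - l] zeros cancel; the other [l - j] are those inserted by [push_to]. *)
    have -> : n - j = (n - l) + (l - j) by rewrite addnBA // subnK // -ltnS.
    by rewrite nseqD -catA all2_leq_nseq0 all2_leq_nseq0_mapS.
  have [le_jl|lt_lj] : (j <= l) \/ (l < j) by apply/orP; case: leqP.
    exists le_jl; rewrite -(represents_le rM) (represents_push_to _ _ rM).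
    rewrite -all2_leq_nseq0_mapS -(all2_leq_nseq0 (n - l)) catA -nseqD.
    by rewrite addnBA // subnK // -ltnS.
  (* If [l < j], then after the common [n - j] zeros the left word continues with a positive entry,
     since [e j x] has length [j > 0], and the right word with 0: a contradiction. *)
  move: le_uv.
  have -> : n - l = (n - j) + (j - l).
    by rewrite addnBA 1?ltnW // subnK // -ltnS.
  rewrite nseqD -catA all2_leq_nseq0.
  have := leq_ltn_trans (leq0n l) lt_lj; rewrite -{1}(sz _ x).
  by move: lt_lj; rewrite -subn_gt0; case: (j - l) (e j x) => [|b] [|a s].
- by move=> n [j x]; rewrite /stack_word /= subSn // -ltnS.
Qed.

Definition ord_word r n (x : chain_pow r n) : seq nat := map val x.

Lemma size_ord_word r n (x : chain_pow r n) : size (ord_word x) = n.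
Proof. by rewrite size_map size_tuple. Qed.

Lemma nth_ord_word r n (x : chain_pow r n) (i : 'I_n) :
  nth 0 (ord_word x) i = tnth x i.
Proof. by rewrite (nth_map (tnth x i)) ?size_tuple // -tnth_nth. Qed.

Lemma ord_word_le r n (x y : chain_pow r n) :
  all2 leq (ord_word x) (ord_word y) = (x <= y)%O.
Proof.
rewrite leEtprod all2E !size_ord_word eqxx /=.
apply/(all_nthP (0, 0))/forallP => [le_xy i|le_xy i].
  have := le_xy i; rewrite size_zip !size_ord_word minnn nth_zip ?size_ord_word //=.
  by rewrite !nth_ord_word; apply.
rewrite size_zip !size_ord_word minnn nth_zip ?size_ord_word //= => lt_in.
by have := le_xy (Ordinal lt_in); rewrite leEord -!nth_ord_word.
Qed.

Lemma ord_word_surj r s :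
  all (geq r) s -> exists x : chain_pow r (size s), ord_word x = s.
Proof.
move=> /allP le_sr; exists (map_tuple inord (in_tuple s)).
rewrite /ord_word /= -map_comp map_id_in // => a /le_sr /= le_ar.
by rewrite inordK.
Qed.

Lemma all_ord_word r n (x : chain_pow r n) : all (geq r) (ord_word x).
Proof. by rewrite all_map; apply/allP => i _ /=; rewrite -ltnS. Qed.

Lemma represents_chain_pow m :
  @represents _ (chain_pow_seq m) (@ord_word m) (slope_word 0 m).
Proof.
(* No entry is below 0, so every adjacent pair is admissible. *)
have slope0 s : sorted (slope_rel 0) s by elim: s => //= a [].
split=> [n x|n x|s /andP[/ord_word_surj]|n x y|] //.
- exact: size_ord_word.
- by rewrite /slope_word all_ord_word slope0.
- exact: ord_word_le.
Qed.

(** Each stacking raises both the threshold and the bound by one, starting from 0 and [m]. *)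
Lemma represents_iter_stack k m :
  exists e, @represents _ (iter_stack k (chain_pow_seq m)) e
                        (slope_word k (k + m)).
Proof.
elim: k => [|k [e rM]] /=; first by exists (@ord_word m); apply: represents_chain_pow.
by exists (stack_word e); apply: represents_stack rM.
Qed.

Lemma slope_condP k r n (x : chain_pow r n) :
  reflect (forall i s : 'I_n, s = i.+1 :> nat -> tnth x s < k ->
             tnth x i <= tnth x s)
          (x \in slope_cond k r n).
Proof.
apply: (iffP forallP) => [Px i s /eqP Ds lt_k|Px i].
  by move/forallP/(_ s): (Px i); rewrite Ds lt_k.
by apply/forallP => s; apply/implyP=> /eqP Ds; apply/implyP; apply: Px.
Qed.

Lemma slope_word_ord_word k r n (x : chain_pow r n) :
  slope_word k r (ord_word x) = (x \in slope_cond k r n).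
Proof.
rewrite /slope_word all_ord_word /=.
apply/(sortedP 0)/slope_condP; rewrite size_ord_word => Px.
  move=> i s Ds lt_k; have := Px i; rewrite -Ds ltn_ord !nth_ord_word.
  by move/(_ isT)/implyP; apply.
move=> i lt_i1n; have lt_in := ltnW lt_i1n.
rewrite (nth_ord_word x (Ordinal lt_in)) (nth_ord_word x (Ordinal lt_i1n)).
by apply/implyP; apply: Px.
Qed.

(** Both posets are faithfully encoded by the same words under the entrywise order, so the
    isomorphism matches elements with equal words. *)
Lemma represents_slope_poset d (M : poset_seq d) e k r n :
  @represents d M e (slope_word k r) -> poset_iso (M n) (slope_poset k r n).
Proof.
move=> rM.
(* The existence statements use the boolean [==] so that [xchoose] can extract [f] and its
   inverse. *)
have lift_word s : size s = n -> slope_word k r s ->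
    exists y : slope_poset k r n, ord_word (val y) == s.
  move=> <- Ps; have [x Dx] := ord_word_surj (proj1 (andP Ps)).
  have Px : x \in slope_cond k r (size s) by rewrite -slope_word_ord_word Dx.
  by exists (exist _ x Px); rewrite /= Dx.
pose f x := xchoose (lift_word _ (represents_size rM x) (represents_mem rM x)).
have fE x : ord_word (val (f x)) = e n x by apply/eqP/(xchooseP (lift_word _ _ _)).
have f_mono : {mono f : x y / (x <= y)%O}.
  by move=> x y; rewrite -(represents_le rM) -!fE ord_word_le.
have word_inj (x y : chain_pow r n) : ord_word x = ord_word y -> x = y.
  by move=> Exy; apply/val_inj/(inj_map val_inj).
have f_surj y : exists x, f x == y.
  have := valP y; rewrite -slope_word_ord_word => /(represents_surj rM)[].
  rewrite size_ord_word => x Dx; exists x.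
  by apply/eqP/val_inj/word_inj; rewrite fE.
exists f => //; exists (fun y => xchoose (f_surj y)) => [x|y].
  exact: (inc_inj f_mono) (eqP (xchooseP (f_surj (f x)))).
exact/eqP/(xchooseP (f_surj y)).
Qed.

(** At position [s] the meet agrees with the smaller of [x] and [y], whose own condition then bounds
    the meet at [i]. If the join is below [k] at [s], so are both [x] and [y], and their two
    inequalities combine. *)
Lemma slope_cond_sublattice k r n : sublattice (slope_cond k r n).
Proof.
split=> x y /slope_condP Px /slope_condP Py; apply/slope_condP=> i s Ds.
  rewrite !tnth_meet; have [le_xy|/ltnW le_yx] := leqP (tnth x s) (tnth y s).
    rewrite meet_l // => /(Px i s Ds); apply: leq_trans.
    exact: (leIl (tnth x i) (tnth y i)).
  rewrite meet_r // => /(Py i s Ds); apply: leq_trans.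
  exact: (leIr (tnth y i) (tnth x i)).
rewrite !tnth_join => lt_k.
have lt_x := leq_ltn_trans (leUl (tnth x s) (tnth y s)) lt_k.
have lt_y := leq_ltn_trans (leUr (tnth y s) (tnth x s)) lt_k.
change (tnth x i `|` tnth y i <= tnth x s `|` tnth y s)%O.
by apply: leU2; [exact: Px lt_x | exact: Py lt_y].
Qed.

Theorem theorem2p1 (k n m : nat) :
  poset_iso (iter_stack k (chain_pow_seq m) n) (slope_poset k (k + m) n)
  /\ sublattice (slope_cond k (k + m) n).
Proof.
split; last exact: slope_cond_sublattice.
by have [e rM] := represents_iter_stack k m; apply: represents_slope_poset rM.
Qed.
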